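(* If $x_0,x_1,\ldots,x_n$ are the Chebyshev points $x_j=\cos(j\pi/n)$, the upper bound $U_{\mathcal R}$ for the rounding error (defined in the context) with $\zeta=x_0=1$ has the following asymptotics in the limit of increasing $n$, for order of differentiation $m=1,2,3,4$, respectively: $$\begin{aligned} U_{\mathcal R}&\sim \gamma_{6n+3}|f|\Bigl(\frac{n^2}{3}+\sum_{k=1}^n\frac{4n^2}{\pi^2k^2}\Bigr)=\gamma_{6n+3}|f|\,0.9995\ldots n^2 &&(m=1),\\ U_{\mathcal R}&\sim \gamma_{6n+2}|f|\Bigl(\frac{n^4}{30}+\sum_{k=1}^n\frac{4n^4}{\pi^2k^2}\Bigl(\frac13-\frac{2}{\pi^2k^2}\Bigr)\Bigr)=\gamma_{6n+2}|f|\,0.1665\ldots n^4 &&(m=2),\\ U_{\mathcal R}&\sim \gamma_{6n+1}|f|\Bigl(\frac{n^6}{630}+\sum_{k=1}^n\frac{2n^6}{15\pi^6k^6}\bigl|\pi^4k^4-20\pi^2k^2+120\bigr|\Bigr)=\gamma_{6n+1}|f|\,0.01109\ldots n^6 &&(m=3),\\ U_{\mathcal R}&\sim \gamma_{6n}|f|\Bigl(\frac{n^8}{22680}+\sum_{k=1}^n\frac{2n^8}{315\pi^8k^8}\bigl|\pi^6k^6-42\pi^4k^4+840\pi^2k^2-5040\bigr|\Bigr)=\gamma_{6n}|f|\,0.00039\ldots n^8 &&(m=4). \end{aligned}$$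
   Context: The $m$-th derivative $f^{(m)}(\zeta)$ is approximated by a finite difference formula $\sum_{k=0}^n w_{k,m}f(x_k)$, where $w_{k,m}$ is the $m$-th derivative at $\zeta$ of the $k$-th Lagrange cardinal function $\prod_{j\ne k}(x-x_j)/\prod_{j\ne k}(x_k-x_j)$. The upper bound for the magnitude of the rounding error in computing it is $$U_{\mathcal R}=\gamma_{6n-m+4}\,|f|\sum_{k=0}^n m!\,|w_k|\,S_{n-m}\bigl(\{|x_0-\zeta|,\ldots,|x_n-\zeta|\}-\{|x_k-\zeta|\}\bigr).$$ Here $w_k=1/\prod_{j\ne k}(x_k-x_j)$ (with $0\le j\le n$) is the Lagrange weight; $S_r$ is the elementary symmetric function of order $r$ (the sum of all products of $r$ entries with distinct indices), with $S_0=1$, and it is applied here to the $n$ entries $|x_j-\zeta|$, $j\ne k$; $|f|=\max_j|f(x_j)|$; $\gamma_p=pu/(1-pu)$, where $u$ is the unit roundoff, and $pu<1$ is implicitly assumed whenever $\gamma_p$ occurs.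
   Formalization: For m=2,3,4 the printed right sides lack the factor m! present in U_R; it is inserted. The printed decimals are not the limits: they are proved as digits of the bracket over n^{2m} at n=1000, and the true limits' digits 1.0000, 0.1666, 0.01111, 0.00039 are given too. *)

(* Defs.v *)
From HB Require Import structures.
From mathcomp Require Export all_boot all_order all_algebra.
From mathcomp Require Export all_classical all_reals all_analysis.

Set Implicit Arguments.
Unset Strict Implicit.
Unset Printing Implicit Defensive.

Import Order.TTheory GRing.Theory Num.Theory.
Import numFieldNormedType.Exports.

Local Open Scope ring_scope.

Section RoundingErrorBound.
Variable R : realType.

(* The same sum as the evaluation at [a] of [mesym n R r] from multinomials,
   whose notations clash with those of MathComp-Analysis. *)
Definition elem_sym (n r : nat) (a : 'I_n -> R) : R :=
  \sum_(h : {set 'I_n} | #|h| == r) \prod_(i in h) a i.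

Definition lagrange_weight (n : nat) (x : 'I_n.+1 -> R) (k : 'I_n.+1) : R :=
  (\prod_(j < n.+1 | j != k) (x k - x j))^-1.

(* Meaningful when [p%:R * u < 1]. *)
Definition gamma (u : R) (p : nat) : R := p%:R * u / (1 - p%:R * u).

Definition grid_norm (n : nat) (f : R -> R) (x : 'I_n.+1 -> R) : R :=
  \big[Num.max/0]_(j < n.+1) `|f (x j)|.

(* [lift k] enumerates the indices distinct from [k], so [elem_sym] gets the n
   entries |x_j - zeta| with j <> k.  The index 6n - m + 4 is written
   6n + 4 - m so that natural subtraction does not truncate for m <= 4. *)
Definition rounding_bound (u : R) (f : R -> R) (n : nat) (x : 'I_n.+1 -> R)
    (zeta : R) (m : nat) : R :=
  gamma u (6 * n + 4 - m) * grid_norm f x *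
  \sum_(k < n.+1) m`!%:R * `|lagrange_weight x k| *
     elem_sym (n - m) (fun j : 'I_n => `|x (lift k j) - zeta|).

(* For n = 0 (irrelevant for asymptotics) this is the single point 1. *)
Definition cheb_points (n : nat) (j : 'I_n.+1) : R := cos (j%:R * pi / n%:R).

(* Leading terms, for m = 1, 2, 3, 4, of the sum in [rounding_bound] at the
   Chebyshev points and zeta = 1 with its factor m! left out.  The first
   summand comes from the node x_0 = 1, the k-th term of the sum from x_k. *)
Definition main_term1 (n : nat) : R :=
  n%:R ^+ 2 / 3 + \sum_(1 <= k < n.+1) 4 * n%:R ^+ 2 / (pi ^+ 2 * k%:R ^+ 2).

Definition main_term2 (n : nat) : R :=
  n%:R ^+ 4 / 30 +
  \sum_(1 <= k < n.+1) 4 * n%:R ^+ 4 / (pi ^+ 2 * k%:R ^+ 2) *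
     (1 / 3 - 2 / (pi ^+ 2 * k%:R ^+ 2)).

Definition main_term3 (n : nat) : R :=
  n%:R ^+ 6 / 630 +
  \sum_(1 <= k < n.+1) 2 * n%:R ^+ 6 / (15 * pi ^+ 6 * k%:R ^+ 6) *
     `|pi ^+ 4 * k%:R ^+ 4 - 20 * pi ^+ 2 * k%:R ^+ 2 + 120|.

Definition main_term4 (n : nat) : R :=
  n%:R ^+ 8 / 22680 +
  \sum_(1 <= k < n.+1) 2 * n%:R ^+ 8 / (315 * pi ^+ 8 * k%:R ^+ 8) *
     `|pi ^+ 6 * k%:R ^+ 6 - 42 * pi ^+ 4 * k%:R ^+ 4
       + 840 * pi ^+ 2 * k%:R ^+ 2 - 5040|.

(* The decimal expansion of [c] begins with the integer part [ip] followed by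
   the digits [ds], truncated and not rounded. *)
Definition has_digits (ip : nat) (ds : seq nat) (c : R) : Prop :=
  let d := ip%:R + \sum_(i < size ds) (nth 0 ds i)%N%:R / 10 ^+ i.+1 in
  d <= c < d + 10 ^- size ds.

End RoundingErrorBound.

Arguments cheb_points : clear implicits.
Arguments main_term1 : clear implicits.
Arguments main_term2 : clear implicits.
Arguments main_term3 : clear implicits.
Arguments main_term4 : clear implicits.

(* Main.v *)
Require Import Defs.
From mathcomp Require Import qpoly zify ring lra.
Import Order.TTheory GRing.Theory Num.Theory.
Import numFieldNormedType.Exports.

Local Open Scope classical_set_scope.
Local Open Scope ring_scope.

(** At [zeta = 1] all the differences [1 - x_j] are nonnegative, so up to sign
the [k]-th summand of the bound is the [m]-th derivative at 1 of the [k]-th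
Lagrange cardinal function.  The weight of [x_k] has the sign [(-1)^k], which
is also the value at [x_k] of the Chebyshev polynomial [T_n].  Interpolating
[T_n] at the nodes therefore turns the sum of absolute values into an exact
formula: the whole sum equals [T_n^(m)(1)], that is, the product over [i < m]
of [(n^2 - i^2) / (2 i + 1)] ([sum_weight_elem_sym], [coef_shifted_cheb]).
Divided by [m! n^(2 m)] it tends to [2^m / (2 m)!], which is 1, 1/6, 1/90 and
1/2520 for [m] = 1, 2, 3, 4.

The leading terms have the same limits.  Put [b_k = 1 / (pi^2 k^2)]; since the
polynomials inside the absolute values are positive at [pi^2 k^2], the leading
term divided by [n^(2 m)] is a constant plus the sum over [k <= n] of a
polynomial of degree at most 4 in [b_k].  The sums of [b_k^r] converge to
[zeta(2 r) / pi^(2 r)], and these four numbers are found by comparing [b_k]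
with the squared cosecant of [k pi / (2 n)]: the power sums of such cosecants
satisfy linear recurrences under doubling of [n], because [a = 1 / sin^2 y] and
[b = 1 / cos^2 y] satisfy [a + b = a b = 4 / sin^2 (2 y)]
([csc_sum_recurrences], [cvg_power_sums]).

Two sequences which are the product of a common factor and of sequences with
the same growth [c n^p], [c <> 0], are equivalent ([equiv_scaled]), whatever
the common factor does; here it is [gamma] times the norm of [f].

The digits of the leading terms at [n = 1000] come from their limits minus the
tail of the series, which lies between multiples of [1 / (n + 1)] and [1 / n]
by telescoping ([sum_tail_bounds]).  The same estimate, stopped after six terms
of the series of [b_k] with sum 1/6, encloses [pi^2] ([pi_sqr_bounds]). *)

(** * Lagrange interpolation and signs of the weights *)

(** Expanding the product amounts to choosing a set of factors that contribute
'X; the coefficient collects the choices of [m] factors, hence the products of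
the [a i] over the complements, which have [n - m] elements. *)
Lemma coef_prod_XaddC (R : realType) n (a : 'I_n -> R) m : (m <= n)%N ->
  (\prod_(i < n) ('X + (a i)%:P))`_m = elem_sym (n - m) a.
Proof.
move=> mn; rewrite bigA_distr.
have prodE (J : {set 'I_n}) :
    \prod_i (if i \in J then 'X else (a i)%:P) =
    (\prod_(i in ~: J) a i) *: 'X^#|J|.
  rewrite (bigID (mem J)) /= (eq_bigr (fun=> 'X)); last by move=> i ->.
  rewrite prodr_const mulrC -mul_polyC rmorph_prod; congr (_ * _).
  by apply: eq_big => [i|i /negPf ->]; rewrite ?inE.
under eq_bigr do rewrite prodE.
rewrite coef_sum /elem_sym (reindex_inj (inv_inj (@finset.setCK _))) /=.
rewrite [RHS]big_mkcond /=; apply: eq_bigr => J _.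
rewrite finset.setCK coefZ coefXn; have := cardsC J; rewrite card_ord => cJ.
have -> : (m == #|~: J|) = (#|J| == n - m)%N by lia.
by case: eqP; rewrite ?mulr1 ?mulr0.
Qed.

(** Interpolation in the form in which the Taylor coefficients of the cardinal
functions can be read off by [coef_prod_XaddC].  The nodes form an infinite
sequence; its terms beyond [n] are arbitrary. *)
Lemma interpolation (R : realType) n (x : nat -> R) (p : {poly R}) :
  injective x -> (size p <= n.+1)%N ->
  p = \sum_(k < n.+1) (p.[x k] * lagrange_weight (fun j : 'I_n.+1 => x j) k) *:
        \prod_(j < n) ('X - (x (lift k j))%:P).
Proof.
move=> x_inj sp; rewrite [LHS](lagrange_gen _ x_inj sp) //.
apply: eq_bigr => k _; rewrite lagrangeE //= mulrA -polyCM mul_polyC.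
rewrite horner_prod /lagrange_weight.
congr ((_ * _^-1) *: _).
  by under eq_bigr do rewrite hornerXsubC.
rewrite (reindex_omap (lift k) (unlift k)) /=; last first.
  by move=> i; case: unliftP => [j ->|->]; rewrite ?eqxx.
by under eq_bigl do rewrite liftK eq_sym eqxx neq_lift.
Qed.

(** The factors [x k - x j] with [j < k] are the negative ones, and there are
[k] of them. *)
Lemma normr_lagrange_weight (R : realType) n (x : 'I_n.+1 -> R) k :
  (forall i j : 'I_n.+1, (i < j)%N -> x j < x i) ->
  `|lagrange_weight x k| = (-1) ^+ k * lagrange_weight x k.
Proof.
move=> x_decr; have signE : (-1) ^+ k = \prod_(j < n.+1 | (j < k)%N) (-1) :> R.
  rewrite -(big_ord_widen _ (fun=> -1)) ?prodr_const ?card_ord //.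
  exact: ltnW.
suff prod_ge0 : 0 <= (-1) ^+ k * \prod_(j < n.+1 | j != k) (x k - x j).
  rewrite -[LHS](normrMsign k) ger0_norm // /lagrange_weight.
  by rewrite -[(-1) ^+ k]invrK -invfM invr_ge0 -exprVn invrN1.
rewrite (bigID [pred j : 'I_n.+1 | (j < k)%N]) signE /= mulrA; apply: mulr_ge0.
  rewrite [X in _ * X](eq_bigl (fun j : 'I_n.+1 => (j < k)%N)) => [|j]; last first.
    by rewrite -val_eqE /=; lia.
  rewrite -big_split /=; apply: prodr_ge0 => j jk.
  by have := x_decr _ _ jk; lra.
apply: prodr_ge0 => j /andP[]; rewrite -val_eqE /= => jk kj.
have kj' : (k < j)%N by lia.
by have := x_decr _ _ kj'; lra.
Qed.

(** * Shifted Chebyshev polynomials *)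

(** [T_n (1 + 'X)]: its coefficients are the Taylor coefficients at 1 of the
Chebyshev polynomial of the first kind. *)
Fixpoint shifted_cheb (R : realType) (n : nat) : {poly R} :=
  match n with
  | 0 => 1
  | 1 => 1 + 'X
  | (n'.+1 as m).+1 => 2 *: ((1 + 'X) * shifted_cheb R m) - shifted_cheb R n'
  end.

Lemma shifted_chebS (R : realType) n : shifted_cheb R n.+2 =
  2 *: ((1 + 'X) * shifted_cheb R n.+1) - shifted_cheb R n.
Proof. by []. Qed.

Lemma size_shifted_cheb (R : realType) n : (size (shifted_cheb R n) <= n.+1)%N.
Proof.
suff : (size (shifted_cheb R n) <= n.+1)%N /\
  (size (shifted_cheb R n.+1) <= n.+2)%N by case.
elim: n => [|n [IH0 IH1]]; first by rewrite /= size_poly1 addrC -polyC1 size_XaddC.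
split=> //; rewrite shifted_chebS.
rewrite (leq_trans (size_polyD _ _)) // geq_max size_polyN.
rewrite (leq_trans IH0) ?andbT //; last by lia.
rewrite (leq_trans (size_scale_leq _ _)) //.
rewrite (leq_trans (size_polyMleq _ _)) //.
by rewrite addrC -polyC1 size_XaddC.
Qed.

Lemma shifted_cheb_cos (R : realType) n (t : R) :
  (shifted_cheb R n).[cos t - 1] = cos (n%:R * t).
Proof.
suff : (shifted_cheb R n).[cos t - 1] = cos (n%:R * t) /\
  (shifted_cheb R n.+1).[cos t - 1] = cos (n.+1%:R * t) by case.
elim: n => [|n [IH0 IH1]].
  by rewrite /= mul0r cos0 mul1r hornerD -!polyC1 !hornerC hornerX subrKC.
split=> //; rewrite shifted_chebS hornerD hornerN hornerZ hornerM hornerD -polyC1.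
rewrite hornerC hornerX IH0 IH1.
have -> : n%:R * t = n.+1%:R * t - t by rewrite -natr1; ring.
have -> : n.+2%:R * t = n.+1%:R * t + t by rewrite -natr1; ring.
by rewrite cosB cosD; ring.
Qed.

(** These are the values of [T_n^(m)(1) / m!].  The recurrence of the Chebyshev
polynomials becomes one between the coefficients, which the closed forms
satisfy. *)
Lemma coef_shifted_cheb (R : realType) n (t := fun m => (shifted_cheb R n)`_m) :
  [/\ t 0 = 1, t 1 = n%:R ^+ 2,
      t 2 = n%:R ^+ 2 * (n%:R ^+ 2 - 1) / 6,
      t 3 = n%:R ^+ 2 * (n%:R ^+ 2 - 1) * (n%:R ^+ 2 - 4) / 90 &
      t 4 = n%:R ^+ 2 * (n%:R ^+ 2 - 1) * (n%:R ^+ 2 - 4) * (n%:R ^+ 2 - 9)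
            / 2520].
Proof.
rewrite {}/t.
pose P n := [/\ (shifted_cheb R n)`_0 = 1, (shifted_cheb R n)`_1 = n%:R ^+ 2,
  (shifted_cheb R n)`_2 = n%:R ^+ 2 * (n%:R ^+ 2 - 1) / 6,
  (shifted_cheb R n)`_3 =
    n%:R ^+ 2 * (n%:R ^+ 2 - 1) * (n%:R ^+ 2 - 4) / 90 &
  (shifted_cheb R n)`_4 =
    n%:R ^+ 2 * (n%:R ^+ 2 - 1) * (n%:R ^+ 2 - 4) * (n%:R ^+ 2 - 9) / 2520].
suff : P n /\ P n.+1 by case.
elim: n => [|n [IH0 IH1]].
  by split; split; rewrite /= ?coefD !coefE /=; ring.
split=> //; case: IH0 => a0 a1 a2 a3 a4; case: IH1 => b0 b1 b2 b3 b4.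
have n1E : n.+1%:R = n%:R + 1 :> R by rewrite natr1.
have n2E : n.+2%:R = n%:R + 2 :> R by rewrite -addn2 natrD.
rewrite {}/P n2E shifted_chebS mulrDl mul1r.
rewrite !(coefB, coefZ, coefD, coefXM) a0 a1 a2 a3 a4 b0 b1 b2 b3 b4 n1E /=.
by move: (n%:R : R) => x; split; field.
Qed.

(** * The sum in the rounding bound *)

Lemma cheb_points_decreasing (R : realType) n (i j : 'I_n.+1) :
  (i < j)%N -> cheb_points R n j < cheb_points R n i.
Proof.
move=> ij; have n_gt0 : 0 < n%:R :> R by rewrite ltr0n; have := ltn_ord j; lia.
have angle_itv (k : 'I_n.+1) : k%:R * pi / n%:R \in `[0, pi : R].
  rewrite in_itv /= divr_ge0 ?mulr_ge0 ?pi_ge0 //=.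
  rewrite ler_pdivrMr // mulrC ler_pM2l ?pi_gt0 // ler_nat.
  by rewrite -ltnS.
by rewrite ltr_cos ?angle_itv // ltr_pM2r ?invr_gt0 // ltr_pM2r ?pi_gt0 // ltr_nat.
Qed.

Lemma shifted_cheb_points (R : realType) n (k : 'I_n.+1) : (0 < n)%N ->
  (shifted_cheb R n).[cheb_points R n k - 1] = (-1) ^+ k.
Proof.
move=> n_gt0; rewrite shifted_cheb_cos mulrCA mulfV ?pnatr_eq0 -?lt0n // mulr1.
by rewrite -[k%:R * pi]add0r mulrC mulr_natr (alternatingn (@cosDpi R)) cos0 mulr1.
Qed.

(** Both the weights and the values of [T_n] at the nodes alternate in sign, so
the sum of absolute values is, coefficient by coefficient, the Lagrange
interpolation of [T_n]. *)
Lemma sum_weight_elem_sym (R : realType) n m (x := cheb_points R n) :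
  (0 < n)%N -> (m <= n)%N ->
  \sum_(k < n.+1) `|lagrange_weight x k| *
     elem_sym (n - m) (fun j : 'I_n => `|x (lift k j) - 1|) =
  (shifted_cheb R n)`_m.
Proof.
move=> n_gt0 mn.
(* The nodes are at most 0; the positive values beyond [n] keep [node]
   injective. *)
pose node (j : nat) : R := if (j <= n)%N then x (inord j) - 1 else j%:R.
have nodeE (j : 'I_n.+1) : node j = x j - 1.
  by rewrite /node -ltnS ltn_ord inord_val.
have node_le0 j : (j <= n)%N -> node j <= 0.
  by rewrite /node => ->; rewrite subr_le0 cos_le1.
have node_lt i j : (i < j <= n)%N -> node j < node i.
  case/andP=> ij jn; have i_n : (i < n.+1)%N by lia.
  have := nodeE (Ordinal i_n); have := nodeE (Ordinal (jn : (j < n.+1)%N)).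
  by move=> /= -> ->; rewrite ltrD2r cheb_points_decreasing.
have node_inj : injective node.
  suff node_neq i j : (i < j)%N -> node i != node j.
    move=> i j /eqP; case: (ltngtP i j) => // /node_neq /negPf.
      by move=> ->.
    by rewrite eq_sym => ->.
  move=> ij; case: (leqP j n) => jn; first by rewrite gt_eqF // node_lt // ij.
  have node_j : node j = j%:R by rewrite /node leqNgt jn.
  case: (leqP i n) => i_n.
    by rewrite lt_eqF // (le_lt_trans (node_le0 _ i_n)) // node_j ltr0n; lia.
  by rewrite node_j /node leqNgt i_n /= eqr_nat; lia.
have wE k : lagrange_weight (fun j : 'I_n.+1 => node j) k = lagrange_weight x k.
  congr (_^-1); apply: eq_bigr => j _; rewrite !nodeE; ring.
rewrite (interpolation _ _ _ _ node_inj (size_shifted_cheb R n)) coef_sum.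
apply: eq_bigr => k _; rewrite coefZ wE nodeE shifted_cheb_points //.
rewrite normr_lagrange_weight; last exact: cheb_points_decreasing.
congr (_ * _); rewrite -coef_prod_XaddC //; congr (polyseq _)`__.
apply: eq_bigr => j _.
by rewrite nodeE ler0_norm ?subr_le0 ?cos_le1 // polyCN.
Qed.

Lemma rounding_bound_cheb (R : realType) (u : R) (f : R -> R) n m :
  (0 < n)%N -> (m <= n)%N ->
  rounding_bound u f (cheb_points R n) 1 m =
  gamma u (6 * n + 4 - m) * grid_norm f (cheb_points R n) *
    (m`!%:R * (shifted_cheb R n)`_m).
Proof.
move=> n_gt0 mn; rewrite -sum_weight_elem_sym // mulr_sumr.
by congr (_ * _); apply: eq_bigr => k _; rewrite mulrA.
Qed.

(** * Growth rates and asymptotic equivalence *)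

(** The common factor [s] may vanish, so the quotient of the two sequences is
not available; the estimate is made on [a] and [b] and multiplied by [s]. *)
Lemma equiv_scaled (R : realType) (U V s a b d : nat -> R) (c : R) :
  c != 0 ->
  (\forall n \near \oo, d n != 0) ->
  (fun n => a n / d n) @ \oo --> c -> (fun n => b n / d n) @ \oo --> c ->
  (\forall n \near \oo, U n = s n * a n) ->
  (forall n, V n = s n * b n) -> U ~_\oo V.
Proof.
move=> c_neq0 d_neq0 ac bc UE VE; apply/eqaddoP => e; move: (e : R) => {}e e_gt0.
have c_gt0 : 0 < `|c| by rewrite normr_gt0.
pose e' : R := Num.min (1 / 2) (e / 4) * `|c|.
have e'_gt0 : 0 < e' by rewrite mulr_gt0 // lt_min; lra.
have e'_le1 : e' <= `|c| / 2 by rewrite /e' mulrC ler_wpM2l // ge_min; lra.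
have e'_le2 : e' <= `|c| * (e / 4).
  by rewrite /e' mulrC ler_wpM2l // ge_min lexx orbT.
clearbody e'.
move/cvgrPdist_le : ac => /(_ _ e'_gt0) ac.
move/cvgrPdist_le : bc => /(_ _ e'_gt0) bc.
near=> n; rewrite -[X in `|X|]/(U n - V n) VE.
have -> : U n = s n * a n by near: n.
have : `|c - a n / d n| <= e' by near: n.
have : `|c - b n / d n| <= e' by near: n.
have dn : d n != 0 by near: n.
set x := b n / d n; set y := a n / d n => xc yc.
have -> : b n = x * d n by rewrite divfK.
have -> : a n = y * d n by rewrite divfK.
clearbody x y.
rewrite -mulrBr -mulrBl !normrM [leRHS]mulrCA ler_wpM2l // mulrA ler_wpM2r //.
have yx : `|y - x| <= 2 * e'.
  have -> : y - x = (c - x) - (c - y) by ring.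
  by rewrite (le_trans (ler_normB _ _)) //; lra.
have x_ge : `|c| / 2 <= `|x|.
  have := ler_normB (c - x) (- x); rewrite opprK subrK normrN; lra.
have := ler_wpM2l (ltW e_gt0) x_ge; lra.
Unshelve. all: by end_near. Qed.

Lemma cvg_invn (R : realType) : (n%:R^-1 : R) @[n --> \oo] --> 0.
Proof.
rewrite -cvg_shiftS; exact: cvg_harmonic.
Qed.

Lemma near_natr_neq0 (R : realType) p :
  \forall n \near \oo, n%:R ^+ p != 0 :> R.
Proof.
near=> n; rewrite expf_neq0 // pnatr_eq0 -lt0n; near: n; exact: nbhs_infty_gt.
Unshelve. all: by end_near. Qed.

Lemma cvg_horner_invn (R : realType) (U : nat -> R) (p : {poly R}) :
  (forall n, (0 < n)%N -> U n = p.[n%:R^-1]) -> U @ \oo --> p.[0].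
Proof.
move=> UE; have cp : p.[n%:R^-1] @[n --> \oo] --> p.[0].
  apply: (@cvg_comp _ _ _ (fun n : nat => n%:R^-1 : R) (horner p)).
    exact: cvg_invn.
  exact: continuous_horner.
apply: cvg_trans cp; apply: near_eq_cvg; near=> n.
by rewrite UE //; near: n; exact: nbhs_infty_gt.
Unshelve. all: by end_near. Qed.

(** The limits are [2^m / (2 m)!]. *)
Lemma cvg_shifted_cheb (R : realType) (t := fun n m => (shifted_cheb R n)`_m) :
  [/\ (fun n => t n 1 / n%:R ^+ 2) @ \oo --> (1 : R),
      (fun n => t n 2 / n%:R ^+ 4) @ \oo --> (6^-1 : R),
      (fun n => t n 3 / n%:R ^+ 6) @ \oo --> (90^-1 : R) &
      (fun n => t n 4 / n%:R ^+ 8) @ \oo --> (2520^-1 : R)].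
Proof.
have natr_neq0 n : (0 < n)%N -> n%:R != 0 :> R by rewrite pnatr_eq0 -lt0n.
have lim_of c (p : {poly R}) (U : nat -> R) : p.[0] = c ->
    (forall n, (0 < n)%N -> U n = p.[n%:R^-1]) -> U @ \oo --> c.
  by move=> <-; exact: cvg_horner_invn.
pose hE := (hornerZ, hornerM, hornerD, hornerN, hornerX, hornerC).
rewrite /t; split.
- apply: (lim_of _ 1) => [|n /natr_neq0 n0]; first by rewrite !hornerE.
  by have [_ -> _ _ _] := coef_shifted_cheb R n; rewrite !hE; field.
- apply: (lim_of _ (6^-1 *: (1%:P - 'X^2))) => [|n /natr_neq0 n0].
    by rewrite !hE; field.
  by have [_ _ -> _ _] := coef_shifted_cheb R n; rewrite !hE; field.
- apply: (lim_of _ (90^-1 *: ((1%:P - 'X^2) * (1%:P - 4 *: 'X^2)))) => [|n /natr_neq0 n0].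
    by rewrite !hE; field.
  by have [_ _ _ -> _] := coef_shifted_cheb R n; rewrite !hE; field.
- apply: (lim_of _ (2520^-1 *: ((1%:P - 'X^2) * (1%:P - 4 *: 'X^2) * (1%:P - 9 *: 'X^2))))
    => [|n /natr_neq0 n0].
    by rewrite !hE; field.
  by have [_ _ _ _ ->] := coef_shifted_cheb R n; rewrite !hE; field.
Qed.

(** * Power sums of squared cosecants *)

Lemma sin_le_id (R : realType) (x : R) : 0 <= x -> sin x <= x.
Proof.
rewrite le_eqVlt => /predU1P[<-|x_gt0]; first by rewrite sin0.
pose g (y : R) := y - sin y.
have dg (y : R) : is_derive y 1 g (1 - cos y) by apply: is_deriveB.
have cg : {within `[0, x], continuous g}.
  apply: derivable_within_continuous => y _; exact: ex_derive.
have [c _] := MVT x_gt0 (fun y _ => dg y) cg.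
rewrite /g sin0 !subr0 => xE.
have : 0 <= (1 - cos c) * x by rewrite mulr_ge0 ?subr_ge0 ?cos_le1 // ltW.
rewrite -xE; lra.
Qed.

(** The derivative of [sin x - x cos x] is [x sin x]. *)
Lemma id_mul_cos_le_sin (R : realType) (x : R) :
  0 <= x <= pi -> x * cos x <= sin x.
Proof.
case/andP; rewrite le_eqVlt => /predU1P[<-|x_gt0 x_le].
  by rewrite sin0 mul0r.
pose g (y : R) := sin y - y * cos y.
have dg (y : R) : is_derive y 1 g (y * sin y).
  by apply: is_derive_eq; rewrite /GRing.scale /=; ring.
have cg : {within `[0, x], continuous g}.
  apply: derivable_within_continuous => y _; exact: ex_derive.
have [c /[!in_itv] /= /andP[c_gt0 c_lt]] := MVT x_gt0 (fun y _ => dg y) cg.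
rewrite /g sin0 !mul0r !subr0 => xE.
have : 0 <= c * sin c * x.
  rewrite !mulr_ge0 ?sin_ge0_pi // ?(ltW c_gt0) ?(ltW x_gt0) //=.
  by rewrite (le_trans (ltW c_lt)).
rewrite -xE; lra.
Qed.

(** The upper bound says [cot x <= 1 / x], the lower one [sin x <= x]. *)
Lemma csc_sqr_bounds (R : realType) (x : R) : 0 < x < pi / 2 ->
  x ^- 2 <= sin x ^- 2 <= x ^- 2 + 1.
Proof.
move=> x_itv; have /andP[x_gt0 x_lt] := x_itv.
have s_gt0 : 0 < sin x by rewrite sin_gt0_pihalf.
have s_le : sin x <= x by rewrite sin_le_id // ltW.
have c_ge0 : 0 <= cos x.
  by rewrite ltW // cos_gt0_pihalf // x_lt andbT; have := pi_gt0 R; lra.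
have c_le : x * cos x <= sin x.
  by rewrite id_mul_cos_le_sin // ltW //=; have := pi_gt0 R; lra.
apply/andP; split.
  rewrite lef_pV2 ?posrE ?exprn_gt0 //.
  by rewrite ler_pXn2r // nnegrE ltW.
have xc2 : x ^+ 2 * cos x ^+ 2 <= sin x ^+ 2.
  by rewrite -exprMn ler_pXn2r // nnegrE ?mulr_ge0 // ltW.
rewrite -subr_ge0 [X in 0 <= X](_ : _ =
    (sin x ^+ 2 - x ^+ 2 * (1 - sin x ^+ 2)) / (x ^+ 2 * sin x ^+ 2)).
  by rewrite -cos2sin2 divr_ge0 ?subr_ge0 // mulr_ge0 // sqr_ge0.
by field; rewrite !gt_eqF.
Qed.

Definition csc_sqr (R : realType) n j : R := sin (j%:R * pi / (2 * n)%:R) ^- 2.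

Definition csc_sum (R : realType) r n : R :=
  \sum_(1 <= j < 2 * n) csc_sqr R n j ^+ r.

Lemma csc_sqr_middle (R : realType) n : (0 < n)%N -> csc_sqr R n n = 1.
Proof.
move=> n_gt0; rewrite /csc_sqr -[_ / _](_ : pi / 2 = _).
  by rewrite sin_pihalf expr1n invr1.
by rewrite !natrM; field; rewrite pnatr_eq0 -lt0n.
Qed.

(** The index [2 n + j] shifts the angle by [pi / 2] and turns the sine into a
cosine; with [s = 1 / sin^2 y] and [c = 1 / cos^2 y], the sum and the product
of [s] and [c] are both [1 / (sin y cos y)^2]. *)
Lemma csc_sqr_half (R : realType) n j (s := csc_sqr R (2 * n) j)
    (c := csc_sqr R (2 * n) (2 * n + j)) : (0 < j < 2 * n)%N ->
  s + c = 4 * csc_sqr R n j /\ s * c = 4 * csc_sqr R n j.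
Proof.
case/andP=> j_gt0 jn; pose y : R := j%:R * pi / (2 * (2 * n))%:R.
have n0 : n%:R != 0 :> R by rewrite pnatr_eq0; lia.
have sE : s = sin y ^- 2 by [].
have cE : c = cos y ^- 2.
  rewrite /c /csc_sqr -sinDpihalf; congr (sin _ ^- 2).
  by rewrite /y natrD !natrM; field.
have -> : csc_sqr R n j = (2 * sin y * cos y) ^- 2.
  rewrite /csc_sqr -[j%:R * _ / _](_ : y *+ 2 = _); last first.
    by rewrite /y !natrM; field.
  rewrite sin_mulr2n; congr (_ ^- 2); ring.
have y_gt0 : 0 < y < pi / 2.
  have jR : 0 < j%:R :> R by rewrite ltr0n.
  have nR : 0 < n%:R :> R by rewrite ltr0n; lia.
  have jnR : j%:R < 2 * n%:R :> R by rewrite -natrM ltr_nat.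
  rewrite /y !natrM divr_gt0 ?mulr_gt0 ?pi_gt0 //=.
  rewrite -subr_gt0 [X in 0 < X](_ : _ = pi * (2 * n%:R - j%:R) / (4 * n%:R)).
    by rewrite divr_gt0 ?mulr_gt0 ?pi_gt0 // subr_gt0.
  by field.
have sy0 : sin y != 0 by rewrite gt_eqF //; exact: sin_gt0_pihalf.
have cy0 : cos y != 0.
  rewrite gt_eqF // cos_gt0_pihalf //.
  by have /andP[] := y_gt0; have := pi_gt0 R; lra.
rewrite sE cE; split; last by field; rewrite ?sy0 ?cy0.
have -> : sin y ^- 2 + cos y ^- 2 = (cos y ^+ 2 + sin y ^+ 2) / (sin y * cos y) ^+ 2.
  by field; rewrite ?sy0 ?cy0.
by rewrite cos2Dsin2; field; rewrite ?sy0 ?cy0.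
Qed.

Lemma csc_sum_double (R : realType) r n : (0 < n)%N ->
  csc_sum R r (2 * n) = 1 + \sum_(1 <= j < 2 * n)
    (csc_sqr R (2 * n) j ^+ r + csc_sqr R (2 * n) (2 * n + j) ^+ r).
Proof.
move=> n_gt0; rewrite /csc_sum (@big_cat_nat _ _ _ (2 * n)); try lia.
rewrite [X in _ + X = _]big_ltn; last lia.
rewrite csc_sqr_middle ?muln_gt0 // expr1n big_split /= addrCA; congr (_ + (_ + _)).
rewrite -[(2 * n).+1]add1n big_addn mul2n -addnn addnK mul2n.
by apply: eq_bigr => j _; rewrite addnC.
Qed.

(** Pairing the angles [y] and [y + pi / 2] gives two numbers with sum and
product [4 c]; the sum of their [r]-th powers is a polynomial in [c], which is
summed over the angles of the coarser grid. *)
Lemma csc_sum_recurrences (R : realType) n (F := fun r => csc_sum R r n)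
    (G := fun r => csc_sum R r (2 * n)) : (0 < n)%N ->
  [/\ G 1 = 1 + 4 * F 1,
      G 2 = 1 + 16 * F 2 - 8 * F 1,
      G 3 = 1 + 64 * F 3 - 48 * F 2 &
      G 4 = 1 + 256 * F 4 - 256 * F 3 + 32 * F 2].
Proof.
move=> n_gt0; rewrite /F /G !csc_sum_double //.
have halfP (a b c : R) : a + b = 4 * c /\ a * b = 4 * c ->
    [/\ a ^+ 1 + b ^+ 1 = 4 * c ^+ 1,
        a ^+ 2 + b ^+ 2 = 16 * c ^+ 2 - 8 * c ^+ 1,
        a ^+ 3 + b ^+ 3 = 64 * c ^+ 3 - 48 * c ^+ 2 &
        a ^+ 4 + b ^+ 4 = 256 * c ^+ 4 - 256 * c ^+ 3 + 32 * c ^+ 2].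
  case=> sumE prodE.
  have -> : a ^+ 2 + b ^+ 2 = (a + b) ^+ 2 - 2 * (a * b) by ring.
  have -> : a ^+ 3 + b ^+ 3 = (a + b) ^+ 3 - 3 * (a * b) * (a + b) by ring.
  have -> : a ^+ 4 + b ^+ 4 =
      ((a + b) ^+ 2 - 2 * (a * b)) ^+ 2 - 2 * (a * b) ^+ 2 by ring.
  by rewrite !expr1 sumE prodE; split; ring.
have half j (jn : (1 <= j < 2 * n)%N) := halfP _ _ _ (csc_sqr_half R n j jn).
rewrite /csc_sum !mulr_sumr; split.
- by congr (_ + _); apply: eq_big_nat => j /half[].
- rewrite -addrA -sumrB; congr (_ + _).
  by apply: eq_big_nat => j /half[].
- rewrite -addrA -sumrB; congr (_ + _).
  by apply: eq_big_nat => j /half[].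
- rewrite -!addrA; congr (_ + _); rewrite addrA -sumrB -big_split /=.
  by apply: eq_big_nat => j /half[].
Qed.

(** Powers of 2 are the indices which the doubling recurrences reach from 1. *)
Lemma csc_sum_pow2 (R : realType) N (F := fun r => csc_sum R r (2 ^ N))
    (M := (2 * 2 ^ N)%:R : R) :
  [/\ F 1 = (M ^+ 2 - 1) / 3,
      F 2 = (M ^+ 4 + 10 * M ^+ 2 - 11) / 45,
      F 3 = (2 * M ^+ 6 + 21 * M ^+ 4 + 168 * M ^+ 2 - 191) / 945 &
      F 4 = (M ^+ 2 - 1) * (3 * M ^+ 6 + 43 * M ^+ 4 + 337 * M ^+ 2 + 2497)
            / 14175].
Proof.
rewrite {}/F {}/M; elim: N => [|N [IH1 IH2 IH3 IH4]].
  have one r : csc_sum R r (2 ^ 0) = 1.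
    by rewrite /csc_sum big_nat1 csc_sqr_middle // expr1n.
  by rewrite !one; split; field.
have N_gt0 : (0 < 2 ^ N)%N by rewrite expn_gt0.
rewrite expnS; have [-> -> -> ->] := csc_sum_recurrences R _ N_gt0.
rewrite IH1 IH2 IH3 IH4 [(2 * (2 * _))%:R]natrM.
by move: ((2 * 2 ^ N)%:R : R) => M; split; field.
Qed.

(** The sum is symmetric under [j -> 2 n - j], with middle term 1. *)
Lemma csc_sum_fold (R : realType) r n : (0 < n)%N ->
  csc_sum R r n = 1 + 2 * \sum_(1 <= j < n) csc_sqr R n j ^+ r.
Proof.
move=> n_gt0; rewrite /csc_sum (@big_cat_nat _ _ _ n); try lia.
rewrite [X in _ + X = _]big_ltn; last lia.
rewrite csc_sqr_middle // expr1n -[n.+1]add1n big_addn mul2n -addnn addnK.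
suff -> : \sum_(1 <= j < n) csc_sqr R n (j + n) ^+ r =
    \sum_(1 <= j < n) csc_sqr R n j ^+ r by rewrite mulr_natl mulr2n addrCA.
rewrite big_nat_rev; apply: eq_big_nat => j /andP[j_gt0 jn]; congr (_ ^+ _).
rewrite /csc_sqr; congr (_ ^- 2).
have -> : (1 + n - j.+1 + n = 2 * n - j)%N by lia.
have -> : (2 * n - j)%:R * pi / (2 * n)%:R = pi - j%:R * pi / (2 * n)%:R :> R.
  by rewrite natrB ?natrM; [field; rewrite pnatr_eq0 -lt0n|lia].
by rewrite sinB sinpi cospi mul0r sub0r mulN1r opprK.
Qed.

(** * Euler's sums *)

Definition inv_sqr_pi (R : realType) (k : nat) : R := (pi ^+ 2 * k%:R ^+ 2)^-1.

Definition power_sum (R : realType) r n : R :=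
  \sum_(1 <= k < n.+1) inv_sqr_pi R k ^+ r.

Lemma inv_sqr_pi_ge0 (R : realType) k : 0 <= inv_sqr_pi R k.
Proof. by rewrite invr_ge0 mulr_ge0 // sqr_ge0. Qed.

(** [csc_sqr_bounds] at [x = j pi / (2 n)], scaled by [1 / (2 n)^2]: the error of
replacing the cosecants by [inv_sqr_pi] is of the order of [n^-2] uniformly in
[j], so that the sum of [n] such errors tends to 0. *)
Lemma csc_sqr_scaled_bounds (R : realType) n j (M := (2 * n)%:R : R) :
  (0 < j < n)%N ->
  inv_sqr_pi R j <= csc_sqr R n j / M ^+ 2 <= inv_sqr_pi R j + M ^- 2.
Proof.
case/andP=> j_gt0 jn; pose x : R := j%:R * pi / M.
have jR : 0 < j%:R :> R by rewrite ltr0n.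
have nR : 0 < n%:R :> R by rewrite ltr0n; lia.
have jnR : j%:R < n%:R :> R by rewrite ltr_nat.
have piR := pi_gt0 R.
have ME : M = 2 * n%:R by rewrite /M natrM.
have M_gt0 : 0 < M by rewrite ME; lra.
have /csc_sqr_bounds : 0 < x < pi / 2.
  rewrite /x divr_gt0 ?mulr_gt0 //= ltr_pdivrMr // ME.
  rewrite [ltRHS](_ : _ = n%:R * pi); last by field.
  by rewrite ltr_pM2r.
rewrite -/(csc_sqr R n j) => /andP[le1 le2].
have -> : inv_sqr_pi R j = x ^- 2 / M ^+ 2.
  rewrite /inv_sqr_pi /x; move: (pi : R) piR => p p_gt0.
  by field; rewrite !lt0r_neq0.
have M2_gt0 : 0 < M ^+ 2 by rewrite exprn_gt0.
rewrite ler_pM2r ?invr_gt0 // le1 /= -[X in _ + X]mul1r -mulrDl.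
by rewrite ler_pM2r ?invr_gt0.
Qed.

Lemma exprB_bounds (R : realType) (x y d : R) r :
  0 <= x -> x <= y -> y <= x + d -> y <= 1 ->
  0 <= y ^+ r - x ^+ r <= r%:R * d.
Proof.
move=> x_ge0 xy yd y_le1; have y_ge0 := le_trans x_ge0 xy.
elim: r => [|r /andP[IH1 IH2]]; first by rewrite !expr0 subrr mul0r lexx.
have xr_ge0 : 0 <= x ^+ r by rewrite exprn_ge0.
have xr_le1 : x ^+ r <= 1 by rewrite exprn_ile1 // (le_trans xy).
rewrite !exprS -natr1.
have -> : y * y ^+ r - x * x ^+ r = y * (y ^+ r - x ^+ r) + (y - x) * x ^+ r.
  by ring.
have h1 : 0 <= (y - x) * x ^+ r by rewrite mulr_ge0 // subr_ge0.
have h2 : (y - x) * x ^+ r <= y - x by rewrite ler_piMr // subr_ge0.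
have h3 : 0 <= y * (y ^+ r - x ^+ r) by rewrite mulr_ge0.
have h4 : y * (y ^+ r - x ^+ r) <= y ^+ r - x ^+ r by rewrite ler_piMl.
have -> : (r%:R + 1) * d = r%:R * d + d by ring.
apply/andP; split; lra.
Qed.

(** Half of [csc_sum] without its middle term is the sum over [j < n], and
[M ^+ (2 * r)] is the scale of its [r]-th powers. *)
Lemma power_sum_csc_sum (R : realType) r n (M := (2 * n)%:R : R) : (0 < n)%N ->
  `|(csc_sum R r n - 1) / 2 / M ^+ (2 * r) - power_sum R r n.-1| <=
  r%:R / 4 / n%:R.
Proof.
move=> n_gt0; rewrite csc_sum_fold // /power_sum prednK //.
have nR : 1 <= n%:R :> R by rewrite ler1n.
have n_gt0R : 0 < n%:R :> R by rewrite ltr0n.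
have ME : M = 2 * n%:R by rewrite /M natrM.
have M_gt0 : 0 < M by rewrite ME; lra.
have -> : (1 + 2 * \sum_(1 <= j < n) csc_sqr R n j ^+ r - 1) / 2 / M ^+ (2 * r) =
    \sum_(1 <= j < n) (csc_sqr R n j / M ^+ 2) ^+ r.
  rewrite addrAC subrr add0r [2 * _]mulrC mulfK //.
  by rewrite mulr_suml; apply: eq_bigr => j _; rewrite expr_div_n exprM.
rewrite -sumrB.
apply: (@le_trans _ _ (\sum_(1 <= j < n) r%:R * M ^- 2)).
  rewrite (le_trans (ler_norm_sum _ _ _)) //; apply: ler_sum_nat => j jn.
  have /andP[le1 le2] := csc_sqr_scaled_bounds R n j jn.
  have j_gt0 : (0 < j)%N by case/andP: jn.
  have j_ge1 : 1 <= j%:R :> R by rewrite ler1n.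
  have inv_le (y : R) : 2 <= y -> y ^- 2 <= 1 / 4.
    move=> y2; rewrite div1r lef_pV2 ?posrE ?exprn_gt0 //; nra.
  have b_le : inv_sqr_pi R j <= 1 / 4.
    rewrite /inv_sqr_pi -exprMn inv_le //.
    have := pi_ge2 R; nra.
  have M_le : M ^- 2 <= 1 / 4 by rewrite inv_le // ME; lra.
  have y_le1 : csc_sqr R n j / M ^+ 2 <= 1 by lra.
  have /andP[ge0 le0] := exprB_bounds R _ _ _ r (inv_sqr_pi_ge0 R j) le1 le2 y_le1.
  by rewrite ger0_norm.
rewrite sumr_const_nat -[_ *+ (n - 1)]mulr_natr natrB // ME.
rewrite -subr_ge0 [X in 0 <= X](_ : _ = r%:R / (4 * n%:R ^+ 2)).
  by rewrite divr_ge0 // mulr_ge0 // exprn_ge0.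
by field; rewrite gt_eqF.
Qed.

Lemma cvgn_ge_id (h : nat -> nat) : (forall n, n <= h n)%N -> h @ \oo --> \oo.
Proof.
move=> hP A [N _ NA]; exists N => // n /= Nn; apply: NA => /=.
exact: leq_trans (hP n).
Qed.

Lemma nondecreasing_subseq_cvgn (R : realType) (u : nat -> R) (h : nat -> nat)
    (L : R) :
  nondecreasing_seq u -> (forall n, n <= h n)%N ->
  u (h n) @[n --> \oo] --> L -> u @ \oo --> L.
Proof.
move=> u_nd hP uhL.
have u_le n : u n <= L.
  apply: cvgr_to_ge uhL _; near=> m; apply: u_nd.
  by rewrite (leq_trans _ (hP m)) //; near: m; exact: nbhs_infty_ge.
apply/cvgrPdist_le => e e_gt0.
have uhL_ge : \forall m \near \oo, L - e <= u (h m).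
  by apply: (cvgr_ge _ uhL); rewrite ltrBlDr ltrDl.
have [m um] := @filter_ex _ _ _ _ uhL_ge.
near=> n; rewrite ger0_norm ?subr_ge0 // lerBlDr -lerBlDl (le_trans um) //.
by apply: u_nd; near: n; exact: nbhs_infty_ge.
Unshelve. all: by end_near. Qed.

Lemma nondecreasing_power_sum (R : realType) r :
  nondecreasing_seq (power_sum R r).
Proof.
apply/nondecreasing_seqP => n; rewrite /power_sum [leRHS]big_nat_recr //=.
by rewrite lerDl exprn_ge0 // inv_sqr_pi_ge0.
Qed.

(** A nondecreasing sequence converges as soon as a subsequence does, so the
closed forms along the powers of 2 suffice. *)
Lemma cvg_power_sum_of_csc (R : realType) r (Q : nat -> R) (L : R) :
  (forall N,
    (csc_sum R r (2 ^ N) - 1) / 2 / (2 * 2 ^ N)%:R ^+ (2 * r) = Q (2 ^ N)%N) ->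
  Q @ \oo --> L -> power_sum R r @ \oo --> L.
Proof.
move=> QE QL; have pow_ge N : (N <= 2 ^ N)%N by rewrite ltnW // ltn_expl.
apply: (@nondecreasing_subseq_cvgn _ _ (fun N => (2 ^ N).-1)).
- exact: nondecreasing_power_sum.
- by move=> n; have := ltn_expl n (isT : 1 < 2)%N; lia.
have {}QL : Q (2 ^ N)%N @[N --> \oo] --> L.
  exact: (cvg_comp _ _ (cvgn_ge_id _ pow_ge) QL).
have err0 : r%:R / 4 / (2 ^ N)%:R @[N --> \oo] --> (0 : R).
  have err0 : r%:R / 4 / n%:R @[n --> \oo] --> (0 : R).
    rewrite -[X in _ --> X](mulr0 (r%:R / 4)).
    by apply: cvgM; [exact: cvg_cst|exact: cvg_invn].
  exact: (cvg_comp _ _ (cvgn_ge_id _ pow_ge) err0).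
have bound N : `|Q (2 ^ N)%N - power_sum R r (2 ^ N).-1| <= r%:R / 4 / (2 ^ N)%:R.
  by rewrite -QE; apply: power_sum_csc_sum; rewrite expn_gt0.
apply/cvgrPdist_le => e e_gt0.
have e2 : 0 < e / 2 by rewrite divr_gt0.
move/cvgrPdist_le : QL => /(_ _ e2) QL.
move/cvgrPdist_le : err0 => /(_ _ e2) err0.
near=> N.
have b := bound N.
have b1 : `|L - Q (2 ^ N)%N| <= e / 2 by near: N.
have : `|0 - r%:R / 4 / (2 ^ N)%:R| <= e / 2 by near: N.
rewrite sub0r normrN => /(le_trans (ler_norm _)) b2.
rewrite -(subrKA (Q (2 ^ N)%N)) (le_trans (ler_normD _ _)) //=; lra.
Unshelve. all: by end_near. Qed.

(** Euler's values of [zeta (2 r) / pi^(2 r)]. *)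
Lemma cvg_power_sums (R : realType) :
  [/\ power_sum R 1 @ \oo --> (6^-1 : R), power_sum R 2 @ \oo --> (90^-1 : R),
      power_sum R 3 @ \oo --> (945^-1 : R) &
      power_sum R 4 @ \oo --> ((945 * 10)^-1 : R)].
Proof.
have lim_of r (p : {poly R}) (c : R) : p.[0] = c ->
    (forall N, (csc_sum R r (2 ^ N) - 1) / 2 / (2 * 2 ^ N)%:R ^+ (2 * r) =
      p.[(2 ^ N)%:R^-1]) ->
    power_sum R r @ \oo --> c.
  move=> <- QE; apply: (cvg_power_sum_of_csc R r (fun n => p.[n%:R^-1])) => //.
  exact: cvg_horner_invn.
have pow_neq0 N : (2 ^ N)%:R != 0 :> R by rewrite pnatr_eq0 -lt0n expn_gt0.
have ME N : (2 * 2 ^ N)%:R = 2 * (2 ^ N)%:R :> R by rewrite natrM.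
pose hE := (hornerZ, hornerM, hornerD, hornerN, hornerX, hornerC).
split.
- apply: (lim_of _ (6^-1 *: (1%:P - 'X^2))) => [|N]; first by rewrite !hE; field.
  have [-> _ _ _] := csc_sum_pow2 R N; rewrite !hE ME.
  by move: (pow_neq0 N); move: ((2 ^ N)%:R : R) => x x0; field.
- apply: (lim_of _ (90^-1 *: (1%:P + (5 / 2) *: 'X^2 - (7 / 2) *: 'X^4))) => [|N].
    by rewrite !hE; field.
  have [_ -> _ _] := csc_sum_pow2 R N; rewrite !hE ME.
  by move: (pow_neq0 N); move: ((2 ^ N)%:R : R) => x x0; field.
- apply: (lim_of _ (945^-1 *: (1%:P + (21 / 8) *: 'X^2 + (21 / 4) *: 'X^4
                               - (71 / 8) *: 'X^6))) => [|N].
    by rewrite !hE; field.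
  have [_ _ -> _] := csc_sum_pow2 R N; rewrite !hE ME.
  by move: (pow_neq0 N); move: ((2 ^ N)%:R : R) => x x0; field.
- apply: (lim_of _ ((945 * 30)^-1 *: (3%:P + 10 *: 'X^2 + (147 / 8) *: 'X^4
                                 + (135 / 4) *: 'X^6 - (521 / 8) *: 'X^8))) => [|N].
    by rewrite !hE; field.
  have [_ _ _ ->] := csc_sum_pow2 R N; rewrite !hE ME.
  by move: (pow_neq0 N); move: ((2 ^ N)%:R : R) => x x0; field.
Qed.

(** * Tails of the series and bounds on the square of pi *)

(** Since [1 / (k (k + 1)) <= 1 / k^2 <= 1 / ((k - 1) k)], adding
[C / (pi^2 N)] to the partial sum of index [N] makes it nonincreasing from [n]
on, and adding [c / (pi^2 (N + 1))] makes it nondecreasing; both modified sums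
still tend to [G]. *)
Lemma sum_tail_bounds (R : realType) (g : nat -> R) (c C G : R) n :
  (0 < n)%N -> 0 <= c ->
  (forall k, (n < k)%N -> c * inv_sqr_pi R k <= g k <= C * inv_sqr_pi R k) ->
  \sum_(1 <= k < N.+1) g k @[N --> \oo] --> G ->
  G - C / (pi ^+ 2 * n%:R) <= \sum_(1 <= k < n.+1) g k
    <= G - c / (pi ^+ 2 * n.+1%:R).
Proof.
move=> n_gt0 c_ge0 gP gG.
have C_ge0 : 0 <= C.
  have /andP[le1 le2] := gP _ (ltnSn n); have := le_trans le1 le2.
  have b_gt0 : 0 < inv_sqr_pi R n.+1.
    by rewrite invr_gt0 mulr_gt0 // exprn_gt0 ?pi_gt0 // ltr0n.
  by rewrite ler_pM2r // => /(le_trans c_ge0).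
pose q : R := pi ^- 2.
have q_ge0 : 0 <= q by rewrite invr_ge0 sqr_ge0.
have bE k : inv_sqr_pi R k = q / k%:R ^+ 2 by rewrite /inv_sqr_pi invfM.
have tailE (a : R) m : a / (pi ^+ 2 * m%:R) = a * q / m%:R.
  by rewrite invfM mulrA.
clearbody q; rewrite !tailE; pose S N := \sum_(1 <= k < N.+1) g k.
have SS N : S N.+1 = S N + g N.+1 by rewrite /S big_nat_recr.
have step_inv (x : R) : 0 < x -> (x + 1)^-1 ^+ 2 <= x^-1 - (x + 1)^-1 /\
    x^-1 - (x + 1)^-1 <= x^-1 ^+ 2.
  move=> x_gt0; split; rewrite -subr_ge0.
    rewrite [X in 0 <= X](_ : _ = (x * (x + 1) ^+ 2)^-1).
      by rewrite invr_ge0 mulr_ge0 ?sqr_ge0 // ltW.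
    by field; apply/andP; split; apply: lt0r_neq0; lra.
  rewrite [X in 0 <= X](_ : _ = (x ^+ 2 * (x + 1))^-1).
    by rewrite invr_ge0 mulr_ge0 ?sqr_ge0 //; lra.
  by field; apply/andP; split; apply: lt0r_neq0; lra.
have upper i : S (n + i)%N + C * q / (n + i)%:R <= S n + C * q / n%:R.
  elim: i => [|i IH]; first by rewrite addn0.
  rewrite (le_trans _ IH) // addnS SS -addrA lerD2l.
  have /andP[_ gle] := gP (n + i).+1 ltac:(lia).
  rewrite (le_trans (lerD gle (lexx _))) // bE.
  have ni : 0 < (n + i)%:R :> R by rewrite ltr0n; lia.
  have [le1 _] := step_inv _ ni.
  have := ler_wpM2l (mulr_ge0 C_ge0 q_ge0) le1.
  rewrite -natr1 -exprVn; lra.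
have lower i : S n + c * q / n.+1%:R <= S (n + i)%N + c * q / (n + i).+1%:R.
  elim: i => [|i IH]; first by rewrite addn0.
  rewrite (le_trans IH) // addnS SS -addrA lerD2l.
  have /andP[gle _] := gP (n + i).+1 ltac:(lia).
  rewrite (le_trans _ (lerD gle (lexx _))) // bE.
  have ni : 0 < (n + i).+1%:R :> R by rewrite ltr0n; lia.
  have [_ le2] := step_inv _ ni.
  have := ler_wpM2l (mulr_ge0 c_ge0 q_ge0) le2.
  by rewrite mulrBr lerBlDr -[leRHS]addrC natr1 exprVn mulrA addrC.
have S_cvg : S (n + i)%N @[i --> \oo] --> G.
  exact: (cvg_comp _ _ (cvgn_ge_id _ (leq_addl n)) gG).
have inv_cvg : (n + i)%:R^-1 @[i --> \oo] --> (0 : R).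
  exact: (cvg_comp _ _ (cvgn_ge_id _ (leq_addl n)) (cvg_invn R)).
have invS_cvg : (n + i).+1%:R^-1 @[i --> \oo] --> (0 : R).
  have le_S i : (i <= (n + i).+1)%N by lia.
  exact: (cvg_comp _ _ (cvgn_ge_id _ le_S) (cvg_invn R)).
have lim_add (a : R) (h : nat -> R) : h @ \oo --> (0 : R) ->
    S (n + i)%N + a * h i @[i --> \oo] --> G.
  move=> h0; rewrite -[X in _ --> X]addr0 -(mulr0 a).
  by apply: cvgD => //; apply: cvgM => //; exact: cvg_cst.
apply/andP; split.
  rewrite lerBlDr; apply: cvgr_to_le (lim_add (C * q) _ inv_cvg) _.
  by near=> i; exact: upper.
rewrite lerBrDr; apply: cvgr_to_ge (lim_add (c * q) _ invS_cvg) _.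
by near=> i; exact: lower.
Unshelve. all: by end_near. Qed.

(** The tail estimate for the series of [1 / (pi^2 k^2)], whose sum is 1/6,
after six terms. *)
Lemma pi_sqr_bounds (R : realType) : 98 / 10 < (pi : R) ^+ 2 < 996 / 100.
Proof.
have [z2 _ _ _] := cvg_power_sums R.
have gP k : (6 < k)%N ->
    1 * inv_sqr_pi R k <= inv_sqr_pi R k ^+ 1 <= 1 * inv_sqr_pi R k.
  by rewrite mul1r expr1 lexx.
have := sum_tail_bounds R _ _ _ _ 6 isT ler01 gP z2.
rewrite 6?big_nat_recr //= big_nil /inv_sqr_pi.
have : 0 < (pi : R) ^+ 2 by rewrite exprn_gt0 ?pi_gt0.
move: ((pi : R) ^+ 2) => s s_gt0; set S := (X in _ <= X <= _) => /andP[le1 le2].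
have s0 : s != 0 by rewrite gt_eqF.
have SE : S * s = 1 + 1 / 4 + 1 / 9 + 1 / 16 + 1 / 25 + 1 / 36.
  by rewrite /S; field.
have err6 : 1 / (s * 6) * s = 1 / 6 by field.
have err7 : 1 / (s * 7) * s = 1 / 7 by field.
move: (ler_wpM2r (ltW s_gt0) le1) (ler_wpM2r (ltW s_gt0) le2).
rewrite !mulrBl SE err6 err7; lra.
Qed.

(** * Normalized leading terms *)

Lemma sqr_pi_mul_ge (R : realType) k : (0 < k)%N ->
  98 / 10 <= pi ^+ 2 * k%:R ^+ 2 :> R.
Proof.
move=> k_gt0; have /andP[pi_ge _] := pi_sqr_bounds R.
have : 1 <= k%:R ^+ 2 :> R by rewrite exprn_ege1 // ler1n.
move: ((pi : R) ^+ 2) (k%:R ^+ 2 : R) pi_ge => s y; nra.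
Qed.

Lemma main_term1_normalized (R : realType) n : (0 < n)%N ->
  main_term1 R n / n%:R ^+ 2 =
  1 / 3 + \sum_(1 <= k < n.+1) 4 * inv_sqr_pi R k.
Proof.
move=> n_gt0; have n0 : n%:R != 0 :> R by rewrite pnatr_eq0 -lt0n.
rewrite /main_term1 mulrDl; congr (_ + _); first by field.
rewrite mulr_suml; apply: eq_big_nat => k /andP[k_gt0 _].
have := sqr_pi_mul_ge R k k_gt0; rewrite /inv_sqr_pi.
move: (pi ^+ 2 * k%:R ^+ 2 : R) => y y_ge.
have y0 : y != 0 by rewrite lt0r_neq0 //; lra.
by field; rewrite n0 y0.
Qed.

Lemma main_term2_normalized (R : realType) n : (0 < n)%N ->
  main_term2 R n / n%:R ^+ 4 =
  1 / 30 + \sum_(1 <= k < n.+1)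
    (4 / 3 * inv_sqr_pi R k - 8 * inv_sqr_pi R k ^+ 2).
Proof.
move=> n_gt0; have n0 : n%:R != 0 :> R by rewrite pnatr_eq0 -lt0n.
rewrite /main_term2 mulrDl; congr (_ + _); first by field.
rewrite mulr_suml; apply: eq_big_nat => k /andP[k_gt0 _].
have := sqr_pi_mul_ge R k k_gt0; rewrite /inv_sqr_pi.
move: (pi ^+ 2 * k%:R ^+ 2 : R) => y y_ge.
have y0 : y != 0 by rewrite lt0r_neq0 //; lra.
by field; rewrite n0 y0.
Qed.

(** The quadratic inside the absolute value is [(y - 10)^2 + 20] at
[y = pi^2 k^2]. *)
Lemma main_term3_normalized (R : realType) n : (0 < n)%N ->
  main_term3 R n / n%:R ^+ 6 =
  1 / 630 + \sum_(1 <= k < n.+1)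
    2 / 15 * (inv_sqr_pi R k - 20 * inv_sqr_pi R k ^+ 2
              + 120 * inv_sqr_pi R k ^+ 3).
Proof.
move=> n_gt0; have n0 : n%:R != 0 :> R by rewrite pnatr_eq0 -lt0n.
rewrite /main_term3 mulrDl; congr (_ + _); first by field.
rewrite mulr_suml; apply: eq_big_nat => k /andP[k_gt0 _].
have := sqr_pi_mul_ge R k k_gt0; rewrite /inv_sqr_pi.
move: (pi : R) (k%:R : R) => p x.
have -> : 15 * p ^+ 6 * x ^+ 6 = 15 * (p ^+ 2 * x ^+ 2) ^+ 3 by ring.
have -> : p ^+ 4 * x ^+ 4 = (p ^+ 2 * x ^+ 2) ^+ 2 by ring.
rewrite -[20 * p ^+ 2 * _]mulrA.
move: (p ^+ 2 * x ^+ 2 : R) => y y_ge.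
have y0 : y != 0 by rewrite lt0r_neq0 //; lra.
rewrite ger0_norm; last by have := sqr_ge0 (y - 10); lra.
by field; rewrite n0 y0.
Qed.

(** The cubic inside the absolute value has its only real root slightly below
9.5, and [pi^2 k^2] is at least 9.8. *)
Lemma main_term4_normalized (R : realType) n : (0 < n)%N ->
  main_term4 R n / n%:R ^+ 8 =
  1 / 22680 + \sum_(1 <= k < n.+1)
    2 / 315 * (inv_sqr_pi R k - 42 * inv_sqr_pi R k ^+ 2
               + 840 * inv_sqr_pi R k ^+ 3 - 5040 * inv_sqr_pi R k ^+ 4).
Proof.
move=> n_gt0; have n0 : n%:R != 0 :> R by rewrite pnatr_eq0 -lt0n.
rewrite /main_term4 mulrDl; congr (_ + _); first by rewrite mulrAC divff ?expf_neq0.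
rewrite mulr_suml; apply: eq_big_nat => k /andP[k_gt0 _].
have := sqr_pi_mul_ge R k k_gt0; rewrite /inv_sqr_pi.
move: (pi : R) (k%:R : R) => p x.
have -> : 315 * p ^+ 8 * x ^+ 8 = 315 * (p ^+ 2 * x ^+ 2) ^+ 4 by ring.
have -> : p ^+ 6 * x ^+ 6 = (p ^+ 2 * x ^+ 2) ^+ 3 by ring.
have -> : 42 * p ^+ 4 * x ^+ 4 = 42 * (p ^+ 2 * x ^+ 2) ^+ 2 by ring.
rewrite -[840 * p ^+ 2 * _]mulrA.
move: (p ^+ 2 * x ^+ 2 : R) => y y_ge.
have y0 : y != 0 by rewrite lt0r_neq0 //; lra.
rewrite ger0_norm; last first.
  (* The quotient of the cubic by [y - 98 / 10] is
     [(y - 161 / 10)^2 + 265.23], and the remainder is positive. *)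
  have : 0 <= (y - 98 / 10) * ((y - 161 / 10) ^+ 2 + 265).
    by apply: mulr_ge0; have := sqr_ge0 (y - 161 / 10); lra.
  lra.
by field; rewrite n0 y0.
Qed.

Lemma cvg_sum_quartic (R : realType) (a1 a2 a3 a4 : R) (b := inv_sqr_pi R) :
  \sum_(1 <= k < n.+1)
     (a1 * b k + a2 * b k ^+ 2 + a3 * b k ^+ 3 + a4 * b k ^+ 4)
    @[n --> \oo] --> a1 / 6 + a2 / 90 + a3 / 945 + a4 / (945 * 10).
Proof.
have [z1 z2 z3 z4] := cvg_power_sums R.
have scale (c : R) r (l : R) : power_sum R r @ \oo --> l ->
    c * power_sum R r n @[n --> \oo] --> c * l.
  by move=> zl; apply: cvgM => //; exact: cvg_cst.
rewrite [X in X @ _ --> _](_ : _ = (fun n =>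
    a1 * power_sum R 1 n + a2 * power_sum R 2 n + a3 * power_sum R 3 n
    + a4 * power_sum R 4 n)); last first.
  by apply/funext => n; rewrite !big_split /= -!mulr_sumr.
by apply: cvgD; [apply: cvgD; [apply: cvgD|]|]; exact: scale.
Qed.

(** Each normalized leading term has the form of [V].  Beyond the index [N] the
terms of the series are nearly linear in [b k], so [c] and [C] can be taken
close to [a1]. *)
Lemma add_sum_quartic_asymptotics (R : realType) (V : nat -> R)
    (a a1 a2 a3 a4 c C : R) (b := inv_sqr_pi R) (N : nat)
    (L := a + (a1 / 6 + a2 / 90 + a3 / 945 + a4 / (945 * 10))) :
  (forall n, (0 < n)%N -> V n = a + \sum_(1 <= k < n.+1)
     (a1 * b k + a2 * b k ^+ 2 + a3 * b k ^+ 3 + a4 * b k ^+ 4)) ->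
  (0 < N)%N -> 0 <= c -> 0 <= C ->
  (forall x : R, 0 <= x -> 0 <= x ^+ 2 <= x / N%:R ^+ 2 ->
     0 <= x ^+ 3 <= x / N%:R ^+ 2 -> 0 <= x ^+ 4 <= x / N%:R ^+ 2 ->
     c * x <= a1 * x + a2 * x ^+ 2 + a3 * x ^+ 3 + a4 * x ^+ 4 <= C * x) ->
  V @ \oo --> L /\
  L - C / (98 / 10 * N%:R) <= V N <= L - c / (996 / 100 * N.+1%:R).
Proof.
move=> VE N_gt0 c_ge0 C_ge0 qP; have sum_cvg := cvg_sum_quartic R a1 a2 a3 a4.
split.
  have aG : a + \sum_(1 <= k < n.+1)
     (a1 * b k + a2 * b k ^+ 2 + a3 * b k ^+ 3 + a4 * b k ^+ 4)
     @[n --> \oo] --> L by apply: cvgD; [exact: cvg_cst|].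
  apply: cvg_trans aG; apply: near_eq_cvg; near=> n.
  by rewrite VE //; near: n; exact: nbhs_infty_gt.
have /andP[pi_ge pi_le] := pi_sqr_bounds R.
have pi2_gt0 : 0 < (pi : R) ^+ 2 by rewrite exprn_gt0 // pi_gt0.
have [lo_gt0 hi_gt0] : 0 < 98 / 10 :> R /\ 0 < 996 / 100 :> R by split; lra.
have NR : 1 <= N%:R :> R by rewrite ler1n.
have NR_gt0 : 0 < N%:R :> R by rewrite ltr0n.
have b_le k : (N < k)%N -> b k <= N%:R ^- 2.
  move=> k_gt; have k_gt0 : 0 < k%:R ^+ 2 :> R.
    by rewrite exprn_gt0 // ltr0n (leq_ltn_trans _ k_gt).
  rewrite /b /inv_sqr_pi lef_pV2 ?posrE ?exprn_gt0 ?(mulr_gt0 pi2_gt0) //.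
  have k2 : N%:R ^+ 2 <= k%:R ^+ 2 :> R.
    by rewrite ler_pXn2r ?nnegrE // ler_nat ltnW.
  by rewrite (le_trans k2) // ler_peMl ?(ltW k_gt0) //; lra.
have N2_le1 : N%:R ^- 2 <= 1 :> R by rewrite invf_le1 ?exprn_gt0 // exprn_ege1.
have pow_le j r : (N < j)%N -> 0 <= b j ^+ r.+2 <= b j / N%:R ^+ 2.
  move=> /b_le bN; have b_ge0 : 0 <= b j := inv_sqr_pi_ge0 R j.
  rewrite exprn_ge0 //= exprS ler_wpM2l //.
  rewrite exprS (le_trans _ bN) // ler_piMr // exprn_ile1 //.
  exact: le_trans bN _.
have g_bounds := fun k (Nk : (N < k)%N) =>
  qP (b k) (inv_sqr_pi_ge0 R k) (pow_le k 0 Nk) (pow_le k 1 Nk) (pow_le k 2 Nk).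
have /andP[le1 le2] := sum_tail_bounds R _ c C _ N N_gt0 c_ge0 g_bounds sum_cvg.
rewrite VE // /L; apply/andP; split.
  rewrite -addrA lerD2l (le_trans _ le1) // lerD2l lerN2 ler_wpM2l //.
  rewrite lef_pV2 ?posrE ?(mulr_gt0 lo_gt0) ?(mulr_gt0 pi2_gt0) //.
  by rewrite ler_pM2r // ltW.
rewrite -addrA lerD2l (le_trans le2) // lerD2l lerN2 ler_wpM2l //.
have NS_gt0 : 0 < N.+1%:R :> R by rewrite ltr0n.
rewrite lef_pV2 ?posrE ?(mulr_gt0 hi_gt0) ?(mulr_gt0 pi2_gt0) //.
by rewrite ler_pM2r // ltW.
Unshelve. all: by end_near. Qed.

(** In these four lemmas the numerical arguments are the constant term, the
coefficients of [b, b^2, b^3, b^4] with [b = 1 / (pi^2 k^2)], and two bounds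
for the ratio to [b] of the terms with [k > 1000], where [b] is below [10^-6]. *)
Lemma main_term1_asymptotics (R : realType) :
  (fun n => main_term1 R n / n%:R ^+ 2) @ \oo --> (1 : R) /\
  has_digits 0 [:: 9; 9; 9; 5]%N (main_term1 R 1000 / 1000 ^+ 2).
Proof.
have [] := @add_sum_quartic_asymptotics R (fun n => main_term1 R n / n%:R ^+ 2)
    (1 / 3) 4 0 0 0 4 4 1000.
- move=> n n_gt0; rewrite main_term1_normalized //; congr (_ + _).
  by apply: eq_bigr => k _; move: (inv_sqr_pi R k) => b; ring.
- by [].
- by lra.
- by lra.
- by move=> x; lra.
rewrite [X in _ --> X](_ : _ = 1); last by field.
move=> lim1 /andP[lo hi]; split => //.
by rewrite /has_digits !big_ord_recl big_ord0 /=; apply/andP; split; lra.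
Qed.

Lemma main_term2_asymptotics (R : realType) :
  (fun n => main_term2 R n / n%:R ^+ 4) @ \oo --> (6^-1 : R) /\
  has_digits 0 [:: 1; 6; 6; 5]%N (main_term2 R 1000 / 1000 ^+ 4).
Proof.
have [] := @add_sum_quartic_asymptotics R (fun n => main_term2 R n / n%:R ^+ 4)
    (1 / 30) (4 / 3) (- 8) 0 0 (13 / 10) (4 / 3) 1000.
- move=> n n_gt0; rewrite main_term2_normalized //; congr (_ + _).
  by apply: eq_bigr => k _; move: (inv_sqr_pi R k) => b; ring.
- by [].
- by lra.
- by lra.
- by move=> x; lra.
rewrite [X in _ --> X](_ : _ = 6^-1); last by field.
move=> lim2 /andP[lo hi]; split => //.
by rewrite /has_digits !big_ord_recl big_ord0 /=; apply/andP; split; lra.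
Qed.

Lemma main_term3_asymptotics (R : realType) :
  (fun n => main_term3 R n / n%:R ^+ 6) @ \oo --> (90^-1 : R) /\
  has_digits 0 [:: 0; 1; 1; 0; 9]%N (main_term3 R 1000 / 1000 ^+ 6).
Proof.
have [] := @add_sum_quartic_asymptotics R (fun n => main_term3 R n / n%:R ^+ 6)
    (1 / 630) (2 / 15) (- (8 / 3)) 16 0 (13 / 100) (14 / 100) 1000.
- move=> n n_gt0; rewrite main_term3_normalized //; congr (_ + _).
  by apply: eq_bigr => k _; move: (inv_sqr_pi R k) => b; field.
- by [].
- by lra.
- by lra.
- by move=> x; lra.
rewrite [X in _ --> X](_ : _ = 90^-1); last by field.
move=> lim3 /andP[lo hi]; split => //.
by rewrite /has_digits !big_ord_recl big_ord0 /=; apply/andP; split; lra.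
Qed.

Lemma main_term4_asymptotics (R : realType) :
  (fun n => main_term4 R n / n%:R ^+ 8) @ \oo --> (2520^-1 : R) /\
  has_digits 0 [:: 0; 0; 0; 3; 9]%N (main_term4 R 1000 / 1000 ^+ 8).
Proof.
have [] := @add_sum_quartic_asymptotics R (fun n => main_term4 R n / n%:R ^+ 8)
    (1 / 22680) (2 / 315) (- (4 / 15)) (16 / 3) (- 32) 0 (1 / 100) 1000.
- move=> n n_gt0; rewrite main_term4_normalized //; congr (_ + _).
  by apply: eq_bigr => k _; move: (inv_sqr_pi R k) => b; field.
- by [].
- by lra.
- by lra.
- by move=> x; lra.
rewrite [X in _ --> X](_ : _ = 2520^-1); last by field.
move=> lim4 /andP[lo hi]; split => //.
by rewrite /has_digits !big_ord_recl big_ord0 /=; apply/andP; split; lra.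
Qed.

(** * Asymptotics of the rounding bound *)

(** [W] is either the leading term or its own asymptotic value [c n^p]. *)
Lemma rounding_bound_equiv (R : realType) (f : R -> R) (u : nat -> R) m p
    (W V : nat -> R) (c : R) : c != 0 ->
  (fun n => (shifted_cheb R n)`_m / n%:R ^+ p) @ \oo --> c ->
  (fun n => W n / n%:R ^+ p) @ \oo --> c ->
  (forall n, V n = gamma (u n) (6 * n + 4 - m) * grid_norm f (cheb_points R n) *
    (m`!%:R * W n)) ->
  (fun n => rounding_bound (u n) f (cheb_points R n) 1 m) ~_\oo V.
Proof.
move=> c_neq0 tc Wc VE.
have scale (w : nat -> R) : (fun n => w n / n%:R ^+ p) @ \oo --> c ->
    (fun n => m`!%:R * w n / n%:R ^+ p) @ \oo --> m`!%:R * c.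
  move=> wc; under eq_fun do rewrite -mulrA.
  by apply: cvgM => //; exact: cvg_cst.
apply: (equiv_scaled _ _ _ _ _ _ (fun n => n%:R ^+ p) (m`!%:R * c) _ _
  (scale _ tc) (scale _ Wc) _ VE).
- by rewrite mulf_neq0 // pnatr_eq0 -lt0n fact_gt0.
- exact: near_natr_neq0.
near=> n; apply: rounding_bound_cheb; near: n; [exact: nbhs_infty_gt|].
exact: nbhs_infty_ge.
Unshelve. all: by end_near. Qed.

Lemma cvg_const_mul_pow (R : realType) p (c : R) :
  (fun n : nat => c * n%:R ^+ p / n%:R ^+ p) @ \oo --> c.
Proof.
have cst_cvg : (fun=> c) @ \oo --> c by exact: cvg_cst.
apply: cvg_trans cst_cvg; apply: near_eq_cvg; near=> n.
by rewrite mulfK //; near: n; exact: near_natr_neq0.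
Unshelve. all: by end_near. Qed.

Theorem theorem7 (R : realType) (f : R -> R) (u : nat -> R)
  (u_gt0 : forall n, 0 < u n) :
  [/\ ((forall n : nat, (6 * n + 3)%N%:R * u n < 1) ->
       [/\ (fun n => rounding_bound (u n) f (cheb_points R n) 1 1) ~_\oo
             (fun n => gamma (u n) (6 * n + 3) * grid_norm f (cheb_points R n) *
                main_term1 R n),
           has_digits 0 [:: 9; 9; 9; 5]%N (main_term1 R 1000 / 1000 ^+ 2) &
           exists c : R,
             [/\ (fun n => main_term1 R n / n%:R ^+ 2) @ \oo --> c,
                 has_digits 1 [:: 0; 0; 0; 0]%N c &
                 (fun n => rounding_bound (u n) f (cheb_points R n) 1 1) ~_\oo
                   (fun n => gamma (u n) (6 * n + 3) * grid_norm f (cheb_points R n) *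
                      (c * n%:R ^+ 2))]]),
      ((forall n : nat, (6 * n + 2)%N%:R * u n < 1) ->
       [/\ (fun n => rounding_bound (u n) f (cheb_points R n) 1 2) ~_\oo
             (fun n => gamma (u n) (6 * n + 2) * grid_norm f (cheb_points R n) *
                (2`!%:R * main_term2 R n)),
           has_digits 0 [:: 1; 6; 6; 5]%N (main_term2 R 1000 / 1000 ^+ 4) &
           exists c : R,
             [/\ (fun n => main_term2 R n / n%:R ^+ 4) @ \oo --> c,
                 has_digits 0 [:: 1; 6; 6; 6]%N c &
                 (fun n => rounding_bound (u n) f (cheb_points R n) 1 2) ~_\oo
                   (fun n => gamma (u n) (6 * n + 2) * grid_norm f (cheb_points R n) *
                      (2`!%:R * c * n%:R ^+ 4))]]),
      ((forall n : nat, (6 * n + 1)%N%:R * u n < 1) ->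
       [/\ (fun n => rounding_bound (u n) f (cheb_points R n) 1 3) ~_\oo
             (fun n => gamma (u n) (6 * n + 1) * grid_norm f (cheb_points R n) *
                (3`!%:R * main_term3 R n)),
           has_digits 0 [:: 0; 1; 1; 0; 9]%N (main_term3 R 1000 / 1000 ^+ 6) &
           exists c : R,
             [/\ (fun n => main_term3 R n / n%:R ^+ 6) @ \oo --> c,
                 has_digits 0 [:: 0; 1; 1; 1; 1]%N c &
                 (fun n => rounding_bound (u n) f (cheb_points R n) 1 3) ~_\oo
                   (fun n => gamma (u n) (6 * n + 1) * grid_norm f (cheb_points R n) *
                      (3`!%:R * c * n%:R ^+ 6))]]) &
      ((forall n : nat, (6 * n)%N%:R * u n < 1) ->
       [/\ (fun n => rounding_bound (u n) f (cheb_points R n) 1 4) ~_\oo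
             (fun n => gamma (u n) (6 * n) * grid_norm f (cheb_points R n) *
                (4`!%:R * main_term4 R n)),
           has_digits 0 [:: 0; 0; 0; 3; 9]%N (main_term4 R 1000 / 1000 ^+ 8) &
           exists c : R,
             [/\ (fun n => main_term4 R n / n%:R ^+ 8) @ \oo --> c,
                 has_digits 0 [:: 0; 0; 0; 3; 9]%N c &
                 (fun n => rounding_bound (u n) f (cheb_points R n) 1 4) ~_\oo
                   (fun n => gamma (u n) (6 * n) * grid_norm f (cheb_points R n) *
                      (4`!%:R * c * n%:R ^+ 8))]])].
Proof.
have [t1 t2 t3 t4] := cvg_shifted_cheb R.
have [lim1 digits1] := main_term1_asymptotics R.
have [lim2 digits2] := main_term2_asymptotics R.
have [lim3 digits3] := main_term3_asymptotics R.
have [lim4 digits4] := main_term4_asymptotics R.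
have c2 : 6^-1 != 0 :> R by rewrite invr_eq0 pnatr_eq0.
have c3 : 90^-1 != 0 :> R by rewrite invr_eq0 pnatr_eq0.
have c4 : 2520^-1 != 0 :> R by rewrite invr_eq0 pnatr_eq0.
have index1 n : (6 * n + 4 - 1 = 6 * n + 3)%N by lia.
have index2 n : (6 * n + 4 - 2 = 6 * n + 2)%N by lia.
have index3 n : (6 * n + 4 - 3 = 6 * n + 1)%N by lia.
have index4 n : (6 * n + 4 - 4 = 6 * n)%N by lia.
split=> _.
- split=> //.
    apply: (rounding_bound_equiv _ _ _ _ _ _ _ _ (oner_neq0 R) t1 lim1) => n.
    by rewrite index1 mul1r.
  exists 1; split => //.
    by rewrite /has_digits !big_ord_recl big_ord0 /=; lra.
  apply: (rounding_bound_equiv _ _ _ _ _ _ _ _ (oner_neq0 R) t1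
            (cvg_const_mul_pow R 2 1)) => n.
  by rewrite index1 !mul1r.
- split=> //.
    apply: (rounding_bound_equiv _ _ _ _ _ _ _ _ c2 t2 lim2) => n.
    by rewrite index2.
  exists 6^-1; split => //.
    by rewrite /has_digits !big_ord_recl big_ord0 /=; lra.
  apply: (rounding_bound_equiv _ _ _ _ _ _ _ _ c2 t2
            (cvg_const_mul_pow R 4 _)) => n.
  by rewrite index2 -[_`!%:R * _ * _]mulrA.
- split=> //.
    apply: (rounding_bound_equiv _ _ _ _ _ _ _ _ c3 t3 lim3) => n.
    by rewrite index3.
  exists 90^-1; split => //.
    by rewrite /has_digits !big_ord_recl big_ord0 /=; lra.
  apply: (rounding_bound_equiv _ _ _ _ _ _ _ _ c3 t3
            (cvg_const_mul_pow R 6 _)) => n.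
  by rewrite index3 -[_`!%:R * _ * _]mulrA.
- split=> //.
    apply: (rounding_bound_equiv _ _ _ _ _ _ _ _ c4 t4 lim4) => n.
    by rewrite index4.
  exists 2520^-1; split => //.
    by rewrite /has_digits !big_ord_recl big_ord0 /=; lra.
  apply: (rounding_bound_equiv _ _ _ _ _ _ _ _ c4 t4
            (cvg_const_mul_pow R 8 _)) => n.
  by rewrite index4 -[_`!%:R * _ * _]mulrA.
Qed.
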